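(* Let $p$ be a prime with $p\equiv 1\pmod 4$. For any $b\in\mathbb{Z}$ with $\left(\frac{b^2+4}{p}\right)=-1$, we have $$\left(\frac{D_p(b,-1)}{p}\right)=\left(\frac{b}{p}\right).$$
   Context: For an odd prime $p$, $\left(\frac{\cdot}{p}\right)$ denotes the Legendre symbol (equal to $0$ on multiples of $p$). For $b,c\in\mathbb{Z}$, $D_p(b,c)$ denotes the integer determinant of the $(p-1)\times(p-1)$ matrix with $(i,j)$ entry $(i^2+bij+cj^2)^{p-2}$: $$D_p(b,c)=\left|(i^2+bij+cj^2)^{p-2}\right|_{1\le i,j\le p-1}.$$ *)

(* Defs.v *)
From HB Require Import structures.
From mathcomp Require Import all_boot all_order all_algebra.

Set Implicit Arguments.
Unset Strict Implicit.
Unset Printing Implicit Defensive.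

Import Order.TTheory GRing.Theory Num.Theory.
Local Open Scope ring_scope.

(* The Legendre symbol (a / p); only meaningful when p is an odd prime. *)
Definition legendre (p : nat) (a : int) : int :=
  if (p%:Z %| a)%Z then 0
  else if [exists x : 'I_p, (x%:Z ^+ 2 == a %[mod p%:Z])%Z] then 1
  else -1.

(* Ordinals of 'I_(p.-1) start at 0, so the indices 1 <= i, j <= p - 1 are
   represented by i.+1 and j.+1. *)
Definition D (p : nat) (b c : int) : int :=
  \det (\matrix_(i < p.-1, j < p.-1)
    ((i.+1)%:Z ^+ 2 + b * (i.+1)%:Z * (j.+1)%:Z + c * (j.+1)%:Z ^+ 2)
      ^+ (p - 2)%N).

(* Main.v *)
Require Import Defs.
From mathcomp Require Import all_boot all_order all_algebra.
From mathcomp Require Import all_fingroup all_field.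
From mathcomp Require Import ring zify.

Import Order.TTheory GRing.Theory Num.Theory.
Local Open Scope ring_scope.

(** Modulo p the entries are the inverses of q(i, j) = i^2 + bij - j^2, which is
    anisotropic because its discriminant b^2 + 4 is not a square.  Put
    V_n = u^n + v^n, where u and v are the conjugate roots of X^2 - bX - 1 in an
    extension of F_p.  A telescoping sum, closed up by V_p = V_1 and
    V_(p+1) = -2, gives
      q(i, j) * \sum_(0 <= k <= p-2) V_(k+2) i^k j^(p-2-k) = - (b^2 + 4) j.
    So, up to column scaling, the matrix is a Vandermonde matrix times
    diag(V_2, ..., V_p) times the transposed Vandermonde matrix with its rows
    reversed, and D_p(b, -1) is a nonzero square times V_2 ... V_p.  Since
    V_(p+1-m) = -(-1)^m V_m, all factors pair up to squares except
    V_p = b and V_((p+1)/2), whose square is -4 and which is therefore itself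
    a square. *)

(** * Lucas sums and their determinants over a ring *)

(** This is V_n, given by its recurrence so that it makes sense in F_p, where u and v do not
    exist. *)
Fixpoint lucas (R : nzRingType) (b : R) (n : nat) : R :=
  match n with
  | 0 => 2
  | m.+1 => match m with 0 => b | k.+1 => b * lucas R b m + lucas R b k end
  end.
Arguments lucas {R} b n : simpl never.

Lemma lucasSS (R : nzRingType) (b : R) n :
  lucas b n.+2 = b * lucas b n.+1 + lucas b n.
Proof. by []. Qed.

Lemma nat_ind2 (P : nat -> Prop) :
  P 0%N -> P 1%N -> (forall n, P n -> P n.+1 -> P n.+2) -> forall n, P n.
Proof.
move=> P0 P1 PSS n; suff [] : P n /\ P n.+1 by [].
by elim: n => [|n [IH1 IH2]]; split=> //; apply: PSS.
Qed.

Lemma rmorph_lucas (R S : nzRingType) (f : {rmorphism R -> S}) (b : R) n :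
  f (lucas b n) = lucas (f b) n.
Proof.
elim/nat_ind2: n => [||n IH1 IH2] //; first exact: (rmorph_nat f 2).
by rewrite !lucasSS rmorphD rmorphM IH1 IH2.
Qed.

Lemma lucas_binet (R : comNzRingType) (u v : R) n :
  u * v = -1 -> lucas (u + v) n = u ^+ n + v ^+ n.
Proof.
move=> uv; elim/nat_ind2: n => [||n IH1 IH2]; rewrite ?expr0 ?expr1 //.
have uvu : u * v * (u ^+ n + v ^+ n) = - (u ^+ n + v ^+ n) by rewrite uv mulN1r.
by rewrite lucasSS IH1 IH2 -[X in _ + X]opprK -uvu !exprS; ring.
Qed.

(** Passing from n to n + 1 multiplies the sum by y and adds one term; the V_(n+2) x^n y^2
    contributions cancel and the recurrence merges the rest. *)
Lemma lucas_telescope (R : comNzRingType) (b x y : R) n :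
  (x ^+ 2 + b * x * y - y ^+ 2) *
    (\sum_(k < n) lucas b k.+2 * x ^+ k * y ^+ (n.-1 - k)) =
  lucas b n.+2 * x ^+ n * y + lucas b n.+1 * x ^+ n.+1
    - (lucas b 2 * y + lucas b 1 * x) * y ^+ n.
Proof.
elim: n => [|n IH]; first by rewrite big_ord0 !expr0 expr1; ring.
rewrite big_ord_recr /= subnn expr0 mulr1.
have -> : \sum_(i < n) lucas b i.+2 * x ^+ i * y ^+ (n - i) =
    y * \sum_(i < n) lucas b i.+2 * x ^+ i * y ^+ (n.-1 - i).
  rewrite big_distrr /=; apply: eq_bigr => i _.
  have -> : (n - i = (n.-1 - i).+1)%N by have := ltn_ord i; lia.
  by rewrite exprS; ring.
by rewrite mulrDr mulrCA IH (lucasSS _ _ n.+1) !exprS; ring.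
Qed.

(** The sign is the parity of the row reversal; it can stay unevaluated because -1 will be a
    square. *)
Lemma det_sum_powers (R : comNzRingType) n (x c : 'I_n -> R) :
  exists s : bool,
  \det (\matrix_(i, j) \sum_(k < n) c k * x i ^+ k * x j ^+ (n.-1 - k)) =
  (-1) ^+ s * \det (Vandermonde n (\row_i x i)) ^+ 2 * \prod_k c k.
Proof.
pose A := Vandermonde n (\row_i x i).
pose s := perm (@rev_ord_inj n).
exists (odd_perm s).
have -> : \matrix_(i, j) (\sum_(k < n) c k * x i ^+ k * x j ^+ (n.-1 - k)) =
    A^T *m diag_mx (\row_k c k) *m (perm_mx s *m A).
  apply/matrixP=> i j; rewrite -row_permE !mxE; apply: eq_bigr => k _.
  rewrite mul_mx_diag !mxE permE /=.
  rewrite (_ : (n - k.+1 = n.-1 - k)%N); last by lia.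
  by rewrite [c k * _]mulrC.
rewrite !det_mulmx det_tr det_diag det_perm -/A.
under eq_bigr do rewrite mxE.
by rewrite mulrCA [_ * _ * \det A]mulrAC mulrA.
Qed.

(** * Square classes and the Legendre symbol over F_p *)

Definition nzsquare (F : fieldType) (x : F) := exists2 w, w != 0 & x = w ^+ 2.
Arguments nzsquare {F} x.

Lemma nzsquareM (F : fieldType) (x y : F) :
  nzsquare x -> nzsquare y -> nzsquare (x * y).
Proof.
move=> [w w0 ->] [z z0 ->]; exists (w * z); first by rewrite mulf_neq0.
by rewrite exprMn.
Qed.

Lemma nzsquare1 (F : fieldType) : nzsquare (1 : F).
Proof. by exists 1; rewrite ?oner_neq0 ?expr1n. Qed.

Section Fp.
Variable p : nat.
Hypothesis p_pr : prime p.

Lemma intr_Fp_nat (x : 'F_p) : (x : nat)%:R = x.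
Proof. by rewrite natr_Zp. Qed.

Lemma legendreE (a : int) : legendre p a =
  if a%:~R == 0 :> 'F_p then 0
  else if [exists x : 'F_p, x ^+ 2 == a%:~R] then 1 else -1.
Proof.
rewrite /legendre (dvdz_pcharf (pchar_Fp p_pr)).
case: eqP => // _; congr (if _ then _ else _); apply/existsP/existsP => -[x].
  rewrite eqz_mod_dvd (dvdz_pcharf (pchar_Fp p_pr)) rmorphB rmorphXn /= subr_eq0.
  by move=> h; exists (x%:Z%:~R).
have ltx : (x < p)%N by rewrite -[X in (_ < X)%N]Fp_cast.
move=> h; exists (Ordinal ltx).
by rewrite eqz_mod_dvd (dvdz_pcharf (pchar_Fp p_pr)) rmorphB rmorphXn /= subr_eq0
  -[_%:~R]/(x%:R) intr_Fp_nat.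
Qed.

Lemma legendre_mul_nzsquare (a b : int) (w : 'F_p) :
  nzsquare w -> a%:~R = w * b%:~R -> legendre p a = legendre p b.
Proof.
move=> [z z0 ->] ab; rewrite !legendreE ab mulf_eq0 expf_eq0 (negPf z0) /=.
case: eqP => // _; congr (if _ then _ else _).
apply/existsP/existsP => -[x /eqP xE].
  by exists (x / z); rewrite expr_div_n xE [_ * b%:~R]mulrC mulfK // expf_neq0.
by exists (z * x); rewrite exprMn xE.
Qed.

Lemma Fp_expp (x : 'F_p) : x ^+ p = x.
Proof. by rewrite -[X in _ ^+ X](card_Fp p_pr) expf_card. Qed.

Lemma Fp_exp_pred (x : 'F_p) : x != 0 -> x ^+ p.-1 = 1.
Proof.
move=> x0; apply: (mulfI x0); rewrite -exprS prednK ?prime_gt0 //.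
by rewrite Fp_expp mulr1.
Qed.

(* The roots of X^2 - bX - 1 are not in F_p, so the Frobenius map swaps them. *)
Lemma frobenius_swap (b : 'F_p) : (forall x, x ^+ 2 != b ^+ 2 + 4) ->
  exists (K : fieldType) (f : {rmorphism 'F_p -> K}) (u v : K),
    [/\ u + v = f b, u * v = -1, u ^+ p = v & v ^+ p = u].
Proof.
move=> nsq; have [K [f _]] := countable_algebraic_closure 'F_p.
have [u uE] : exists u : K, u ^+ 2 = f b * u + 1.
  have /closed_rootP[u] : size ('X^2 - (f b *: 'X + 1%:P)) != 1%N.
    rewrite size_polyDl ?size_polyXn // size_polyN.
    rewrite (leq_ltn_trans (size_polyD _ _)) // gtn_max size_polyC.
    by rewrite (leq_ltn_trans (size_scale_leq _ _)) ?size_polyX ?oner_neq0.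
  by rewrite rootE !hornerE subr_eq0 => /eqP; exists u.
have chK : p \in [pchar K] by rewrite (fmorph_pchar f) pchar_Fp.
have addXp (x y : K) : (x + y) ^+ p = x ^+ p + y ^+ p.
  by rewrite exprDn_pchar // pnatE.
have fXp x : f x ^+ p = f x by rewrite -rmorphXn Fp_expp.
pose v := f b - u.
have uv : u * v = -1 by rewrite /v mulrBr mulrC -expr2 uE; ring.
have upv : u ^+ p = v.
  (* Frobenius fixes [f b], so u^p is again a root of X^2 - bX - 1. *)
  have : (u ^+ p - u) * (u ^+ p - v) = 0.
    have : (u ^+ p) ^+ 2 = f b * u ^+ p + 1.
      by rewrite exprAC uE addXp exprMn fXp expr1n.
    move=> h.
    have -> : (u ^+ p - u) * (u ^+ p - v) = (u ^+ p) ^+ 2 - (u + v) * u ^+ p + u * v by ring.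
    by rewrite uv h /v; ring.
  move/eqP; rewrite mulf_eq0 !subr_eq0 => /orP[/eqP uu|/eqP //].
  (* If u^p = u, then u is a root of X^p - X, the product of all X - x with x in F_p, so u = f x;
     then 2x - b is a square root of b^2 + 4. *)
  have := congr1 (fun q => (map_poly f q).[u]) (finField_genPoly 'F_p).
  rewrite card_Fp // rmorphB /= map_polyXn map_polyX !hornerE uu subrr rmorph_prod.
  rewrite horner_prod => /esym/eqP /prodf_eq0[x _].
  rewrite rmorphB /= map_polyX map_polyC !hornerE subr_eq0 => /eqP ux.
  have /negP[] := nsq (2 * x - b); apply/eqP/(fmorph_inj f).
  move: uE; rewrite ux => /eqP; rewrite -subr_eq0 => /eqP h.
  apply/eqP; rewrite -subr_eq0 !(rmorphXn, rmorphD, rmorphB, rmorphM, rmorph_nat) /=.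
  by apply/eqP; rewrite -[RHS](mulr0 4) -h; ring.
exists K, f, u, v; split=> //; first by rewrite /v; ring.
have : (u + v) ^+ p = u + v.
  by rewrite /v addrC subrK fXp.
by rewrite addXp upv addrC => /addIr.
Qed.

(** * The Lucas sequence modulo p *)

Section LucasModp.
Variable b : 'F_p.
Hypothesis nsq : forall x, x ^+ 2 != b ^+ 2 + 4.

Lemma lucas_p : lucas b p = b.
Proof.
have [K [f [u [v [uvb uv up vp]]]]] := frobenius_swap b nsq.
apply: (fmorph_inj f).
by rewrite rmorph_lucas -uvb lucas_binet // up vp addrC.
Qed.

Lemma lucas_pS : lucas b p.+1 = -2.
Proof.
have [K [f [u [v [uvb uv up vp]]]]] := frobenius_swap b nsq.
apply: (fmorph_inj f).
rewrite rmorph_lucas -uvb lucas_binet // !exprS up vp [v * u]mulrC uv.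
by rewrite rmorphN rmorph_nat; ring.
Qed.

(** Since u^(p+1) = uv = -1, one gets u^k = -u^(-m) = -(-1)^m v^m, and likewise with u and v
    exchanged. *)
Lemma lucas_reflect m k : (m + k = p.+1)%N ->
  lucas b k = - (-1) ^+ m * lucas b m.
Proof.
move=> mk; have [K [f [u [v [uvb uv up vp]]]]] := frobenius_swap b nsq.
have uv1 : (-1) ^+ m * (u ^+ m * v ^+ m) = 1.
  by rewrite -exprMn uv -exprMn mulrNN mulr1 expr1n.
have upk : u ^+ m * u ^+ k = -1 by rewrite -exprD mk exprS up.
have vpk : v ^+ m * v ^+ k = -1 by rewrite -exprD mk exprS vp mulrC.
apply: (fmorph_inj f).
rewrite rmorphM rmorphN rmorphXn rmorphN1 !rmorph_lucas -uvb !lucas_binet //.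
transitivity (((-1) ^+ m * (u ^+ m * v ^+ m)) * (u ^+ k + v ^+ k)).
  by rewrite uv1 mul1r.
transitivity ((-1) ^+ m * (v ^+ m * (u ^+ m * u ^+ k) + u ^+ m * (v ^+ m * v ^+ k))).
  by ring.
by rewrite upk vpk; ring.
Qed.

Hypothesis p1mod4 : (p %% 4 = 1)%N.

Lemma natr2_neq0 : (2 : 'F_p) != 0.
Proof.
rewrite -(dvdn_pcharf (pchar_Fp p_pr)) gtnNdvd //.
by have := prime_gt1 p_pr; move: p1mod4; lia.
Qed.

Lemma natr4_neq0 : (4 : 'F_p) != 0.
Proof. by rewrite (_ : 4 = 2 * 2) ?mulf_neq0 ?natr2_neq0 //; ring. Qed.

(** The square is u^(p+1) + v^(p+1) + 2 (uv)^((p+1)/2) = -1 - 1 - 2, as (p+1)/2 is odd. *)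
Lemma sqr_lucas_half : lucas b p.+1./2 ^+ 2 = -4.
Proof.
have [K [f [u [v [uvb uv up vp]]]]] := frobenius_swap b nsq.
have pE : (p.+1 = p.+1./2 + p.+1./2)%N by move: p1mod4; lia.
have odd_half : odd p.+1./2 by move: p1mod4; lia.
apply: (fmorph_inj f).
rewrite rmorphXn rmorph_lucas -uvb lucas_binet // sqrrD -!exprM !muln2 -addnn -pE.
rewrite !exprS up vp -exprMn [v * u]mulrC uv -signr_odd odd_half.
by rewrite rmorphN rmorph_nat expr1; ring.
Qed.

(* If u^m = - v^m, then u^(2m) = -(-1)^m; raising this to the odd power
   (p + 1)/2 and using u^(p+1) = -1 gives (-1)^m = -(-1)^m. *)
Lemma lucas_neq0 m : lucas b m != 0.
Proof.
have [K [f [u [v [uvb uv up vp]]]]] := frobenius_swap b nsq.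
have pE : (p.+1 = 2 * p.+1./2)%N by move: p1mod4; lia.
have odd_half : odd p.+1./2 by move: p1mod4; lia.
rewrite -(fmorph_eq0 f) rmorph_lucas -uvb lucas_binet //.
apply/negP; rewrite addr_eq0 => /eqP umv.
have u2m : u ^+ (2 * m) = - (-1) ^+ m.
  by rewrite mul2n -addnn exprD {1}umv mulNr -exprMn [v * u]mulrC uv.
have /eqP := congr1 (fun x => x ^+ p.+1./2) u2m.
rewrite /= -exprM mulnAC -pE exprM exprS up uv (exprNn ((-1) ^+ m)).
rewrite -[(-1) ^+ p.+1./2]signr_odd odd_half expr1 mulN1r -exprM mulnC exprM.
rewrite -[(-1) ^+ p.+1./2]signr_odd odd_half expr1 -addr_eq0 -mulr2n.
rewrite -mulr_natr mulf_eq0 signr_eq0 /= -(rmorph_nat f) fmorph_eq0.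
by rewrite (negPf natr2_neq0).
Qed.

Lemma nzsquareN1 : nzsquare (-1 : 'F_p).
Proof.
exists (lucas b p.+1./2 / 2); first by rewrite mulf_neq0 ?invr_eq0 ?lucas_neq0 ?natr2_neq0.
rewrite expr_div_n sqr_lucas_half.
by field; exact: natr4_neq0.
Qed.

(* A square root z of -4 is itself a square: with i = z/2 one has
   (1 + i)^2 = 2i = z. *)
Lemma nzsquare_lucas_half : nzsquare (lucas b p.+1./2).
Proof.
have z0 := lucas_neq0 p.+1./2; have := sqr_lucas_half.
move: (lucas b _) z0 => z z0 zE.
have sqz : (1 + z / 2) ^+ 2 = z.
  by rewrite sqrrD expr_div_n zE; field; rewrite natr2_neq0 ?natr4_neq0.
exists (1 + z / 2) => //; apply: contraNneq z0 => h.
by rewrite -sqz h expr0n.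
Qed.

Lemma nzsquare_sign n : nzsquare ((-1) ^+ n : 'F_p).
Proof.
elim: n => [|n IH]; first exact: nzsquare1.
by rewrite exprS; apply: nzsquareM => //; apply: nzsquareN1.
Qed.

Lemma prod_lucas : exists2 w, nzsquare w & \prod_(k < p.-1) lucas b k.+2 = w * b.
Proof.
(* The indices 2, ..., p form two blocks of length h + 1, ending at (p+1)/2 and at p. The other h
   indices of each block are paired as m and p + 1 - m, after reversing the second block. *)
pose h := (p.+1./2 - 2)%N.
have p1 := prime_gt1 p_pr.
have pE : (p.-1 = h.+1 + h.+1)%N by rewrite /h; move: p1mod4 p1; lia.
have hE : (h.+2 = p.+1./2)%N by rewrite /h; move: p1mod4 p1; lia.
have bE : ((h + h.+1).+2 = p)%N by move: p1mod4 p1; rewrite /h; lia.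
rewrite -(big_mkord xpredT (fun k => lucas b k.+2)) pE.
rewrite (big_cat_nat (n := h.+1)) ?leq_addr // big_nat_recr //=.
rewrite -{2}[h.+1]add0n big_addn addnK big_nat_recr //= bE lucas_p hE.
rewrite [X in _ * (X * _)]big_nat_rev /=.
rewrite mulrA -mulrA; set P := \prod_(_ <= _ < _) _; set Q := \prod_(_ <= _ < _) _.
exists (P * Q * lucas b p.+1./2); last by rewrite /P /Q; ring.
apply: nzsquareM; last exact: nzsquare_lucas_half.
rewrite /P /Q -big_split /= big_nat.
apply: (big_ind nzsquare); [exact: nzsquare1 | exact: nzsquareM | move=> k /andP[_ kh]].
rewrite (lucas_reflect k.+2 (0 + h - k.+1 + h.+1).+2); last by move: kh bE; lia.
rewrite mulrCA -expr2; apply: nzsquareM; last by exists (lucas b k.+2); rewrite ?lucas_neq0.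
by rewrite -mulN1r -exprS; apply: nzsquare_sign.
Qed.

(** * The determinant modulo p *)

Let x (i : 'I_p.-1) : 'F_p := i.+1%:R.

Lemma natrS_neq0 i : x i != 0.
Proof.
rewrite /x -(dvdn_pcharf (pchar_Fp p_pr)) gtnNdvd //.
by have := ltn_ord i; have := prime_gt1 p_pr; lia.
Qed.

Lemma Vandermonde_neq0 : \det (Vandermonde p.-1 (\row_i x i)) != 0.
Proof.
rewrite det_Vandermonde; apply/prodf_neq0 => i _; apply/prodf_neq0 => j ij.
rewrite !mxE /x -natrB; last by rewrite ltnW.
rewrite -(dvdn_pcharf (pchar_Fp p_pr)) gtnNdvd ?subn_gt0 //.
by have := ltn_ord j; have := prime_gt1 p_pr; lia.
Qed.

Lemma prod_natrS : \prod_i x i = -1.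
Proof.
have /eqP : ((p.-1)`!.+1%:R : 'F_p) == 0.
  by rewrite -(dvdn_pcharf (pchar_Fp p_pr)) -Wilson ?prime_gt1.
rewrite -natr1 => /eqP; rewrite addr_eq0 => /eqP <-.
by rewrite fact_prod natr_prod big_add1 big_mkord.
Qed.

(* Entrywise, the Lucas sum is the matrix on the left times -(b^2 + 4) x_j,
   because the powers t^(p-2) and t^-1 agree on nonzero t. *)
Lemma det_quadratic : exists2 w, nzsquare w &
  \det (\matrix_(i < p.-1, j < p.-1)
     (x i ^+ 2 + b * x i * x j - x j ^+ 2) ^+ (p - 2)) = w * b.
Proof.
have p1 := prime_gt1 p_pr.
set E := \matrix_(i, j) _.
have [s] := det_sum_powers _ _ x (fun k : 'I_p.-1 => lucas b k.+2).
set G := \matrix_(i, j) _; move=> detG.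
pose d := - (b ^+ 2 + 4).
have d0 : d != 0.
  by rewrite oppr_eq0 eq_sym; have := nsq 0; rewrite expr0n.
have GE : G = E *m diag_mx (\row_j (d * x j)).
  apply/matrixP=> i j; rewrite mul_mx_diag !mxE.
  set q := _ + _ - _.
  (* For n = p - 1, Fermat removes the powers, and the terms in [x i] cancel because V_p = V_1. *)
  have qG := lucas_telescope _ b (x i) (x j) p.-1.
  rewrite -/q !exprS !Fp_exp_pred ?natrS_neq0 // prednK ?(ltnW p1) // in qG.
  rewrite lucas_p lucas_pS in qG.
  set S := \sum_(_ < _) _ in qG *.
  have qd : q * S = d * x j.
    by rewrite qG !lucasSS /lucas /d; ring.
  (* Anisotropy comes for free: q divides the nonzero [d * x j]. *)
  have q0 : q != 0.
    apply: contraTneq (mulf_neq0 d0 (natrS_neq0 j)) => q0.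
    by rewrite -qd q0 mul0r eqxx.
  rewrite -qd mulrA -exprSr (_ : (p - 2).+1 = p.-1)%N; last by lia.
  by rewrite Fp_exp_pred // mul1r.
move: detG; rewrite GE det_mulmx det_diag.
under eq_bigr do rewrite mxE.
(* The column factors multiply to d^(p-1) (p-1)! = -1, by Fermat and Wilson. *)
rewrite big_split /= prodr_const card_ord Fp_exp_pred // mul1r prod_natrS.
have [w wsq ->] := prod_lucas; rewrite mulrN1 => detE.
exists (-1 * ((-1) ^+ s * \det (Vandermonde p.-1 (\row_i x i)) ^+ 2) * w).
  apply: nzsquareM => //; apply: nzsquareM; first exact: nzsquareN1.
  apply: nzsquareM; first exact: nzsquare_sign.
  by exists (\det (Vandermonde p.-1 (\row_i x i))); rewrite ?Vandermonde_neq0.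
by rewrite -[\det E]opprK detE mulN1r !mulNr mulrA.
Qed.

End LucasModp.

End Fp.

Theorem corollary1p1 (p : nat) (hp : prime p) (hp4 : p = 1 %[mod 4])
    (b : int) (hb : legendre p (b ^+ 2 + 4) = -1) :
  legendre p (D p b (-1)) = legendre p b.
Proof.
have nsq (x : 'F_p) : x ^+ 2 != b%:~R ^+ 2 + 4.
  move: hb; rewrite legendreE // rmorphD rmorphXn /=.
  case: eqP => // _; case: existsP => // nex _.
  by apply/negP => /eqP xE; apply: nex; exists x; rewrite xE.
have [w wsq detE] := det_quadratic p hp (b%:~R) nsq hp4.
apply: (legendre_mul_nzsquare p hp _ _ w wsq); rewrite -detE /D -det_map_mx.
congr (\det _); apply/matrixP => i j.
by rewrite !mxE rmorphXn !rmorphD !rmorphM rmorphN1 mulN1r.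
Qed.
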